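(* Let $(X,\tau)$ be a first countable $T_1$ space. Assume that for any set-valued map $S:X\rightrightarrows X$ and any f-t-contractive $S$-orbit $M=\{x_i\}_{i=1}^\infty$, the condition $S(\bar{x})\subseteq\{\bar{x}\}$ holds for every strong accumulation point $\bar{x}$ of $M$ at which $S$ is lower semicontinuous on $M$. Then $X$ is a Hausdorff space.
   Context: A set-valued map $S:X\rightrightarrows X$ assigns to each $x\in X$ a (possibly empty) subset $S(x)\subseteq X$; $\operatorname{dom} S:=\{x\in X:S(x)\ne\emptyset\}$. An infinite $S$-orbit is a sequence $\{x_i\}_{i=1}^\infty$ in $X$ with $x_{i+1}\in S(x_i)$ for all $i\ge1$. An infinite $S$-orbit $\{x_i\}_{i=1}^\infty$ is f-t-contractive (feebly topologically contractive) if for every open cover $\gamma$ of $X$ there exist $U\in\gamma$ and $i_0\in\mathbb{N}$ such that $x_{i_0}\in U$ and $S(x_{i_0})\subseteq U$. A point $\bar x\in X$ is a strong accumulation point of an infinite $S$-orbit $\{x_i\}_{i=1}^\infty$ if every neighborhood $U_{\bar x}$ of $\bar x$ satisfies $\{x_i\}\cup S(x_i)\subseteq U_{\bar x}$ for infinitely many $i$; equivalently (in a first countable space) there is a subsequence $\{x_{i_k}\}_{k=1}^\infty$ with $x_{i_k}\to\bar x$ and such that whenever $a_k\in S(x_{i_k})$ for all $k$, also $a_k\to\bar x$. Writing $M$ also for the set of points of the orbit and $\operatorname{cl}M$ for its closure, $S$ is lower semicontinuous on $M$ at $x\in\operatorname{cl}M\cap\operatorname{dom}S$ if for every open $V\subseteq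 X$ with $S(x)\cap V\ne\emptyset$ there is an open neighborhood $U\subseteq X$ of $x$ such that $S(x')\cap V\neq\emptyset$ for all $x'\in U\cap M$. *)

(* Defs.v *)
From mathcomp Require Import all_boot all_order.
From mathcomp Require Import all_classical all_analysis.

Set Implicit Arguments.
Unset Strict Implicit.
Unset Printing Implicit Defensive.

Local Open Scope classical_set_scope.

(* A set-valued map on X is a function S : X -> set X, with empty values
   allowed. *)
Definition set_valued_dom (X : Type) (S : X -> set X) : set X :=
  [set x | S x !=set0].

(* Orbits are indexed from 0; repetitions among the terms are allowed. *)
Definition infinite_orbit (X : Type) (S : X -> set X) (x : nat -> X) : Prop :=
  forall i, S (x i) (x i.+1).

Definition first_countable (X : topologicalType) : Prop :=
  forall x : X, exists B : set (set X),
    [/\ countable B,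
        forall U, B U -> nbhs x U &
        forall V, nbhs x V -> exists2 U, B U & U `<=` V].

Definition open_cover (X : topologicalType) (gamma : set (set X)) : Prop :=
  (forall U, gamma U -> open U) /\ cover gamma id = setT.

Definition ft_contractive_orbit (X : topologicalType) (S : X -> set X)
    (x : nat -> X) : Prop :=
  infinite_orbit S x /\
  forall gamma : set (set X), open_cover gamma ->
    exists2 U, gamma U & exists i0, U (x i0) /\ S (x i0) `<=` U.

(* "Infinitely many i" counts indices, not values of the sequence. *)
Definition strong_accumulation_point (X : topologicalType) (S : X -> set X)
    (x : nat -> X) (xbar : X) : Prop :=
  forall U, nbhs xbar U ->
    infinite_set [set i : nat | [set x i] `|` S (x i) `<=` U].

Definition lsc_on_at (X : topologicalType) (S : X -> set X) (M : set X)
    (x : X) : Prop :=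
  [/\ closure M x, set_valued_dom S x &
      forall V : set X, open V -> S x `&` V !=set0 ->
        exists2 U, open_nbhs x U &
          forall x', (U `&` M) x' -> S x' `&` V !=set0].

(* Main.v *)
Require Import Defs.
From mathcomp Require Import all_boot all_order.
From mathcomp Require Import all_classical all_analysis.

Local Open Scope classical_set_scope.

(** If [a] and [b] cannot be separated, first countability gives a sequence [y]
    converging to both, and T1 lets it avoid [a].  Send [y i] to [y i.+1] and
    [a] to [b]: then [y] is an f-t-contractive orbit having [a] as a strong
    accumulation point, and lower semicontinuity at [a] holds because the
    successors of the points near [a] tend to [b].  The hypothesis then yields
    [b = a]. *)

(** Take finite intersections of an enumerated base at [a]: each [D n] with [n > m] lies in the
    [m]-th base set. *)
Lemma first_countable_shrinking_nbhs {X : topologicalType} (a : X) :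
  first_countable X ->
  exists2 D : nat -> set X, forall n, nbhs a (D n) &
    forall V, nbhs a V -> \forall n \near \oo, D n `<=` V.
Proof.
move=> /(_ a)[B [Bcount Bnbhs Bbasis]].
have [B0|[F]] : B = set0 \/ $|{surjfun [set: nat] >-> B}|.
  exact/pfcard_geP.
(* An empty base is impossible: the whole space is a neighbourhood of [a], so it must contain a base
   member. *)
- by have [U] := Bbasis _ (@filterT _ (nbhs a) _); rewrite B0.
- exists (fun n => \bigcap_(i < n) F i) => [n|V aV].
    rewrite bigcap_mkord; elim/big_ind: _ => [|U V|i _].
    + exact: filterT.
    + exact: filterI.
    + by apply: Bnbhs; exact: (@funS _ _ _ _ F).
  have [U BU UV] := Bbasis V aV.
  have [m _ FmU] := @surj _ _ _ _ F U BU.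
  exists m.+1 => // n /= mn z Dz.
  by apply: UV; rewrite -FmU; exact: Dz.
Qed.

Lemma accessible_nbhs_avoid {X : topologicalType} {A : set X} {a : X} :
  accessible_space X -> finite_set A -> ~ A a -> open_nbhs a (~` A).
Proof.
move=> T1 Afin Aa; split=> //.
by apply: closed_openC; exact: (accessible_finite_set_closed.1 T1).
Qed.

(** Every neighbourhood of [a] meets every neighbourhood of [b], so [y i] can be chosen in shrinking
    neighbourhoods of both; by T1, the one at [b] may omit [a]. *)
Lemma cluster_common_limit {X : topologicalType} {a b : X} :
  first_countable X -> accessible_space X -> a <> b ->
  cluster (nbhs a) b ->
  exists y : nat -> X,
    [/\ forall i, y i <> a, y @ \oo --> a & y @ \oo --> b].
Proof.
move=> fc T1 ab clab.
have [D Da Dsmall] := first_countable_shrinking_nbhs a fc.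
have [E Eb Esmall] := first_countable_shrinking_nbhs b fc.
have bNa : nbhs b (~` [set a]).
  apply: open_nbhs_nbhs; apply: accessible_nbhs_avoid => //.
  by move=> /= ba; exact: ab.
have /choice[y yP] i : exists z, D i z /\ (E i `&` ~` [set a]) z.
  by apply: clab => //; exact: filterI.
exists y; split=> [i|V aV|V bV]; first by have [_ []] := yP i.
- by apply: filterS (Dsmall V aV) => i; apply; have [] := yP i.
- by apply: filterS (Esmall V bV) => i; apply; have [_ []] := yP i.
Qed.

(* A value may be repeated in [y], so [y i] is sent to the successors of all
   its occurrences. *)
Definition shift_map {X : Type} (y : nat -> X) (a b : X) : X -> set X :=
  fun x => [set z | (x = a /\ z = b) \/ exists i, x = y i /\ z = y i.+1].

Section ShiftMap.
Context {X : topologicalType} (T1 : accessible_space X).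
Context {y : nat -> X} {a : X} (b : X).
Hypotheses (yNa : forall i, y i <> a) (ya : y @ \oo --> a).

(** As [y] avoids [a], the orbit clause contributes nothing at [a]. *)
Lemma shift_map_base : shift_map y a b a = [set b].
Proof.
apply/seteqP; split=> z /=; last by left.
by case=> [[]//|[i [/esym/yNa]]].
Qed.

Lemma nbhs_avoid_prefix N : open_nbhs a (~` (y @` `I_N)).
Proof.
apply: accessible_nbhs_avoid => //; first exact: finite_image.
by case=> i _ /yNa.
Qed.

(** Let [y n] lie in [U] from [N] on. By T1, late terms differ from the first [N] values, so every
    occurrence of such a term has index at least [N] and all its successors lie in [U]. *)
Lemma near_orbit_shift_map {U} : nbhs a U ->
  \forall i \near \oo, [set y i] `|` shift_map y a b (y i) `<=` U.
Proof.
move=> aU; have [N _ yU] := ya _ aU.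
have aN : \forall i \near \oo, (~` (y @` `I_N)) (y i).
  by apply: ya; apply: open_nbhs_nbhs; exact: nbhs_avoid_prefix.
near=> i => z [->|[[/yNa//]|[j [yij ->]]]].
  by near: i; exact: ya.
have yiN : (~` (y @` `I_N)) (y i) by near: i.
apply: yU => /=; apply: leqW; rewrite leqNgt; apply/negP => jN.
by apply: yiN; exists j.
Unshelve. all: by end_near. Qed.

Lemma shift_map_ft_contractive : ft_contractive_orbit (shift_map y a b) y.
Proof.
split=> [i|gamma [gopen gcover]]; first by right; exists i.
have [U gU Ua] : cover gamma id a by rewrite gcover.
(* The cover member around the limit [a] absorbs a late term with all its successors. *)
exists U => //.
have aU : nbhs a U by apply: open_nbhs_nbhs; split=> //; exact: gopen.
have [N _ /(_ N (leqnn N)) /= NU] := near_orbit_shift_map aU.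
by exists N; split; [apply: NU; left | move=> z Sz; apply: NU; right].
Qed.

Lemma shift_map_strong_accumulation :
  strong_accumulation_point (shift_map y a b) y a.
Proof.
move=> U aU; have [N _ NU] := near_orbit_shift_map aU.
apply: (cofinite_set_infinite infinite_nat).
apply: sub_finite_set (finite_II N) => i /= iNU.
by rewrite ltnNge; apply/negP => Ni; apply: iNU; exact: NU.
Qed.

Lemma shift_map_lsc : y @ \oo --> b ->
  lsc_on_at (shift_map y a b) (range y) a.
Proof.
move=> yb; split.
- move=> U /ya[N _ /(_ N (leqnn N)) /= UyN].
  by exists (y N); split=> //; exists N.
- by exists b; rewrite shift_map_base.
- move=> V Vopen; rewrite shift_map_base => -[_ [-> Vb]].
  have [N _ yV] := yb V (open_nbhs_nbhs (conj Vopen Vb)).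
  (* An orbit point outside the first [N] values occurs only at indices from [N] on, so its
     successor is in [V]. *)
  exists (~` (y @` `I_N)); first exact: nbhs_avoid_prefix.
  move=> x [/= yiN [i _ yiE]]; rewrite -{x}yiE in yiN *.
  exists (y i.+1); split; first by right; exists i.
  apply: yV => /=; apply: leqW; rewrite leqNgt; apply/negP => iN.
  by apply: yiN; exists i.
Qed.
End ShiftMap.

Theorem corollary4p6 (X : topologicalType)
  (X_first_countable : first_countable X)
  (X_T1 : accessible_space X)
  (X_orbits : forall (S : X -> set X) (x : nat -> X),
    ft_contractive_orbit S x ->
    forall xbar : X,
      strong_accumulation_point S x xbar ->
      lsc_on_at S (range x) xbar ->
      S xbar `<=` [set xbar]) :
  hausdorff_space X.
Proof.
move=> a b clab; apply: contrapT => ab.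
have [y [yNa ya yb]] := cluster_common_limit X_first_countable X_T1 ab clab.
have := X_orbits _ _ (shift_map_ft_contractive X_T1 b yNa ya) a
  (shift_map_strong_accumulation X_T1 b yNa ya)
  (shift_map_lsc X_T1 b yNa ya yb).
by rewrite shift_map_base// => /(_ b erefl)/= /esym.
Qed.
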